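(* Let $K$ be a (not necessarily commutative) field, let $U\neq\{0\}$ be a left vector space over $K$, let $\varphi:K\to\mathrm{End}_K(U)$ be a representation (ring homomorphism preserving $1$), and let $\Phi$ be the associated projective representation of $\mathbb{P}(K)$ in $\mathbb{P}(K,U\times U)$. Assume that $\mathbb{P}(K,U\times U)$ is spanned by the transversals of $\mathbb{P}(K)^\Phi$. Let $\mathcal{T}_\theta$, $\theta\in\Theta$, be the equivalence classes of projectively linked transversals, and for $\theta\in\Theta$ let $U_\theta\times U_\theta$ (with $U_\theta$ a subspace of $U$) be the subspace of $U\times U$ generated by $\mathcal{T}_\theta$. Then $$U\times U=\bigoplus_{\theta\in\Theta}(U_\theta\times U_\theta).$$ Moreover, for each $\theta\in\Theta$, the trace $\{p^\Phi\cap(U_\theta\times U_\theta)\mid p\in\mathbb{P}(K)\}$ of $\mathbb{P}(K)^\Phi$ in $\mathbb{P}(K,U_\theta\times U_\theta)$ is a regulus in $\mathbb{P}(K,U_\theta\times U_\theta)$.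
   Context: Conventions: ''field'' means a division ring, not necessarily commutative; ring homomorphisms preserve $1$. Endomorphisms act on the right, written exponentially, and are composed from left to right; so $\varphi:k\mapsto\rho_k$ turns $U$ into a $(K,K)$-bimodule via $u\cdot k:=u^{\rho_k}$. $\mathbb{P}(K,V)$ is the projective space of subspaces of a left $K$-vector space $V$; its points (lines) are the $1$-dimensional ($2$-dimensional) subspaces. $\mathbb{P}(K)$ is the set of $1$-dimensional subspaces $K(k,l)$ of the left vector space $K^2$. The projective representation associated to $\varphi$ is the mapping $\Phi$ with $K(k,l)^\Phi=\{(u\cdot k,u\cdot l)\mid u\in U\}$, a subspace of $U\times U$. $\mathbb{P}(K)^\Phi$ is the set of all these subspaces; they are pairwise complementary. A line $T$ of $\mathbb{P}(K,U\times U)$ is a transversal of $\mathbb{P}(K)^\Phi$ if $T$ meets each element of $\mathbb{P}(K)^\Phi$ in a unique point and each point of $T$ lies on an element of $\mathbb{P}(K)^\Phi$ (which is then unique). Every transversal has the form $T=Ku\times Ku$ with $u\in U\setminus\{0\}$; hence the subspace generated by a set of transversals has the form $U'\times U'$ with $U'$ a subspace of $U$. For two transversals $T_1,T_2$ of $\mathbb{P}(K)^\Phi$ define the mapping $\pi_{12}:T_1\to T_2$ between their point sets by $T_1\cap p^\Phi\mapsto T_2\cap p^\Phi$ for $p\in\mathbb{P}(K)$. $T_1$ and $T_2$ are projectively linked if $\pi_{12}$ is a projectivity, i.e. induced by a $K$-linear bijection of the $2$-dimensional subspace $T_1$ onto $T_2$. This is an equivalence relation on the set of all transversals of $\mathbb{P}(K)^\Phi$.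 Regulus: given a left $K$-vector space $W\neq\{0\}$ with basis $(b_i)_{i\in I}$, the set of all subspaces $$\Big\{\Big(\sum_{i\in I}x_ikb_i,\ \sum_{i\in I}x_ilb_i\Big)\ \Big|\ x_i\in K,\ \text{almost all } x_i=0\Big\},\qquad K(k,l)\in\mathbb{P}(K),$$ is a regulus in $\mathbb{P}(K,W\times W)$, and the reguli in $\mathbb{P}(K,W\times W)$ are exactly the sets of subspaces that are projectively equivalent to it, i.e. its images under $K$-linear automorphisms of $W\times W$. *)

(* Defs.v *)
From HB Require Import structures.
From mathcomp Require Import all_boot all_order all_algebra.
From mathcomp Require Import mathcomp_extra boolp classical_sets functions.
From mathcomp Require Import cardinality fsbigop.

Set Implicit Arguments.
Unset Strict Implicit.
Unset Printing Implicit Defensive.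

Import GRing.Theory.
Local Open Scope classical_set_scope.
Local Open Scope ring_scope.

(* Fields are not assumed commutative, hence fieldType cannot be used. *)
Definition is_division_ring (K : unitRingType) : Prop :=
  forall x : K, x != 0 -> x \is a GRing.unit.

(** * Subspaces of a left vector space, as sets of vectors *)

Definition is_subspace (K : unitRingType) (V : lmodType K) (S : set V) : Prop :=
  S 0 /\ forall (a : K) (v w : V), S v -> S w -> S (a *: v + w).

Definition gen (K : unitRingType) (V : lmodType K) (A : set V) : set V :=
  smallest (@is_subspace K V) A.

(* The bases may be infinite: in [\sum_(i \in setT)] only finitely many summands
   are nonzero, because x has finite support. *)
Definition is_free (K : unitRingType) (V : lmodType K) (I : choiceType)
    (b : I -> V) : Prop :=
  forall x : I -> K, finite_set [set i | x i != 0] ->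
    \sum_(i \in [set: I]) x i *: b i = 0 -> forall i, x i = 0.

Definition is_basis (K : unitRingType) (V : lmodType K) (S : set V)
    (I : choiceType) (b : I -> V) : Prop :=
  is_free b /\ gen (range b) = S.

Definition has_dim (K : unitRingType) (V : lmodType K) (n : nat)
    (S : set V) : Prop :=
  exists b : 'I_n -> V, is_basis S b.

Definition is_point (K : unitRingType) (V : lmodType K) (S : set V) : Prop :=
  has_dim 1 S.

Definition is_line (K : unitRingType) (V : lmodType K) (S : set V) : Prop :=
  has_dim 2 S.

Definition linear_on (K : unitRingType) (V W : lmodType K) (S : set V)
    (f : V -> W) : Prop :=
  forall (a : K) (v w : V), S v -> S w -> f (a *: v + w) = a *: f v + f w.

(* f restricts to a K-linear bijection of the subspace S onto the subspace S';
   its values outside S are irrelevant. *)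
Definition linear_bij (K : unitRingType) (V W : lmodType K) (S : set V)
    (S' : set W) (f : V -> W) : Prop :=
  linear_on S f /\ set_bij S S' f.

Definition is_direct_sum (K : unitRingType) (V : lmodType K) (I : Type)
    (D : set I) (S : I -> set V) (W : set V) : Prop :=
  [/\ forall i, D i -> is_subspace (S i),
      gen (\bigcup_(i in D) S i) = W &
      forall i, D i -> S i `&` gen (\bigcup_(j in D `\ i) S j) = [set 0]].

(** * Representations and the projective line over K *)

(* Endomorphisms act on the right and are composed from left to right, whence
   the order of the factors in [reprM]; [phi k u] is the right action u.k. *)
Record representation (K : unitRingType) (U : lmodType K) := Representation {
  repr_fun :> K -> {linear U -> U};
  reprD : forall (k l : K) (u : U),
    repr_fun (k + l) u = repr_fun k u + repr_fun l u;
  reprM : forall (k l : K) (u : U), repr_fun (k * l) u = repr_fun l (repr_fun k u);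
  repr1 : forall u : U, repr_fun 1 u = u }.

(* K(k,l), a subspace of the left vector space K^2. *)
Definition Kspan (K : unitRingType) (k l : K) : set (K^o * K^o)%type :=
  [set (a * k, a * l) | a in [set: K]].

Definition PK (K : unitRingType) : set (set (K^o * K^o)%type) :=
  [set p | is_point p].

Definition graph_sub (K : unitRingType) (U : lmodType K)
    (phi : representation U) (k l : K) : set (U * U)%type :=
  [set (phi k u, phi l u) | u in [set: U]].

Definition Phi (K : unitRingType) (U : lmodType K) (phi : representation U)
    (p : set (K^o * K^o)%type) : set (U * U)%type :=
  [set w | exists k l : K, p = Kspan k l /\ graph_sub phi k l w].

(* The image of K(k,l) does not depend on the representative (k,l). *)
Lemma Phi_Kspan (K : unitRingType) (U : lmodType K) (phi : representation U)
    (k l : K) : Phi phi (Kspan k l) = graph_sub phi k l.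
Proof.
apply/seteqP; split=> [w [k' [l' [E [u _ <-]]]]|w Hw]; last by exists k, l.
have : Kspan k l (k', l') by rewrite E; exists 1 => //; rewrite !mul1r.
by case=> a _ [<- <-]; exists (phi a u) => //; rewrite !reprM.
Qed.

(** * Transversals *)

Definition is_transversal_line (K : unitRingType) (U : lmodType K)
    (phi : representation U) (T : set (U * U)%type) : Prop :=
  [/\ is_line T,
      forall p, PK p ->
        exists! q : set (U * U)%type,
          [/\ is_point q, q `<=` T & q `<=` Phi phi p] &
      forall q : set (U * U)%type, is_point q -> q `<=` T ->
        exists2 p, PK p & q `<=` Phi phi p].

(* The graph of the mapping pi_12 between the point sets of T1 and T2. *)
Definition pi12 (K : unitRingType) (U : lmodType K) (phi : representation U)
    (T1 T2 q1 q2 : set (U * U)%type) : Prop :=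
  exists p, [/\ PK p, q1 = T1 `&` Phi phi p & q2 = T2 `&` Phi phi p].

Definition proj_linked (K : unitRingType) (U : lmodType K)
    (phi : representation U) (T1 T2 : set (U * U)%type) : Prop :=
  exists2 f : (U * U)%type -> (U * U)%type, linear_bij T1 T2 f &
    forall q1 q2, pi12 phi T1 T2 q1 q2 -> f @` q1 = q2.

Definition link_class (K : unitRingType) (U : lmodType K)
    (phi : representation U) (T : set (U * U)%type) : set (set (U * U)%type) :=
  [set T' | is_transversal_line phi T' /\ proj_linked phi T T'].

Definition link_classes (K : unitRingType) (U : lmodType K)
    (phi : representation U) : set (set (set (U * U)%type)) :=
  [set link_class phi T | T in [set T | is_transversal_line phi T]].

(* The subspace generated by a set of subspaces. *)
Definition gen_union (K : unitRingType) (V : lmodType K) (C : set (set V)) :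
    set V :=
  gen (\bigcup_(T in C) T).

(** * Reguli *)

Definition std_regulus_elt (K : unitRingType) (U : lmodType K) (I : choiceType)
    (b : I -> U) (k l : K) : set (U * U)%type :=
  [set (\sum_(i \in [set: I]) (x i * k) *: b i,
        \sum_(i \in [set: I]) (x i * l) *: b i)
     | x in [set x : I -> K | finite_set [set i | x i != 0]]].

Definition std_regulus (K : unitRingType) (U : lmodType K) (I : choiceType)
    (b : I -> U) : set (set (U * U)%type) :=
  [set S | exists2 kl : K * K, PK (Kspan kl.1 kl.2) &
           S = std_regulus_elt b kl.1 kl.2].

(* R is a regulus in the projective space on W x W. *)
Definition is_regulus (K : unitRingType) (U : lmodType K) (W : set U)
    (R : set (set (U * U)%type)) : Prop :=
  [/\ is_subspace W, W <> [set 0] &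
      exists (I : choiceType) (b : I -> U) (g : (U * U)%type -> (U * U)%type),
        [/\ is_basis W b, linear_bij (W `*` W) (W `*` W) g &
            R = [set g @` S | S in std_regulus b]]].

Definition trace (K : unitRingType) (U : lmodType K) (phi : representation U)
    (W : set U) : set (set (U * U)%type) :=
  [set Phi phi p `&` (W `*` W) | p in @PK K].

(* Main.v *)
(* A transversal is K u x K u with u <> 0 an eigenvector: u.k = alpha(k) u for a
   surjective alpha : K -> K.  Two transversals are projectively linked iff,
   after rescaling one of the two eigenvectors, they have the same alpha; hence
   the class of K u x K u generates W x W, with W spanned by all v satisfying
   v.k = alpha(k) v.
   Choose a basis B of U made of eigenvectors.  If an eigenvector v has a nonzero
   component x b along b in B, then x b has the eigenvalue map of v, so v and b
   lie in the same class.  Hence the summand of a class lies in the hyperplane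
   spanned by B \ b for every b in B of another class, and directness follows as
   these hyperplanes meet in 0.  Finally, with a basis of W on which K acts
   through alpha, the trace on W x W is the standard regulus, reparametrized by
   (k, l) |-> (alpha k, alpha l). *)

Require Import Defs.
From HB Require Import structures.
From mathcomp Require Import all_boot all_order all_algebra.
From mathcomp Require Import mathcomp_extra boolp classical_sets functions.
From mathcomp Require Import cardinality fsbigop.
Import GRing.Theory.
Local Open Scope classical_set_scope.
Local Open Scope ring_scope.

Set Implicit Arguments.
Unset Strict Implicit.

(** * Subspaces, generated subspaces and finitely supported linear combinations *)

Section Subspaces.
Context (K : unitRingType) (V : lmodType K).
Implicit Types (A B S : set V) (v w : V).

Lemma subspaceD S v w : is_subspace S -> S v -> S w -> S (v + w).
Proof. by move=> [_ h] Sv Sw; rewrite -[v]scale1r; exact: h. Qed.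

Lemma subspaceZ S a v : is_subspace S -> S v -> S (a *: v).
Proof. by move=> [S0 h] Sv; rewrite -[_ *: _]addr0; exact: h. Qed.

Lemma subspaceB S v w : is_subspace S -> S v -> S w -> S (v - w).
Proof.
by move=> hS Sv Sw; rewrite -scaleN1r; apply: subspaceD => //; exact: subspaceZ.
Qed.

Lemma subspace_fsum S (I : choiceType) (D : set I) (F : I -> V) :
  is_subspace S -> (forall i, D i -> S (F i)) -> S (\sum_(i \in D) F i).
Proof.
move=> hS h; case: finite_supportP => [_|X XD _ _]; first by rewrite big_nil; exact: hS.1.
rewrite big_seq; apply: (big_ind S) => [||i /XD]; [exact: hS.1| |exact: h].
by move=> x y; exact: subspaceD.
Qed.

Lemma gen_subspace A : is_subspace (gen A).
Proof.
split=> [S [[]]//|a v w Av Aw S [hS AS]].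
by apply: hS.2; [apply: Av|apply: Aw].
Qed.

Lemma sub_gen A : A `<=` gen A.
Proof. exact: sub_gen_smallest. Qed.

Lemma gen_min A S : is_subspace S -> A `<=` S -> gen A `<=` S.
Proof. exact: smallest_sub. Qed.

Lemma gen_sub A B : A `<=` gen B -> gen A `<=` gen B.
Proof. by apply: gen_min; exact: gen_subspace. Qed.

Lemma gen_mono A B : A `<=` B -> gen A `<=` gen B.
Proof. by move=> AB; apply: gen_sub => v /AB; exact: sub_gen. Qed.

Lemma gen_setU1 A v w : gen (v |` A) w -> exists a y, gen A y /\ w = a *: v + y.
Proof.
apply: (@gen_min _ [set w | exists a y, gen A y /\ w = a *: v + y]); last first.
  move=> u [->|Au].
    by exists 1, 0; split; [exact: (gen_subspace A).1|rewrite scale1r addr0].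
  by exists 0, u; split; [exact: sub_gen|rewrite scale0r add0r].
split; first by exists 0, 0; split; [exact: (gen_subspace A).1|rewrite scale0r addr0].
move=> c _ _ [a [y [Ay ->]]] [b [z [Az ->]]].
exists (c * a + b), (c *: y + z); split; first exact: (gen_subspace A).2.
by rewrite scalerDr scalerA scalerDl addrACA.
Qed.

(** Directedness makes the union of the spans [gen (X i)] a subspace. This carries independence over
    to unions of chains in [exists_indep]. *)
Lemma gen_bigcup_directed (I : Type) (D : set I) (X : I -> set V) w :
    D !=set0 ->
    (forall i j, D i -> D j -> exists2 k, D k & X i `<=` X k /\ X j `<=` X k) ->
  gen (\bigcup_(i in D) X i) w -> exists2 i, D i & gen (X i) w.
Proof.
move=> [i0 Di0] dir.
apply: (@gen_min _ [set w | exists2 i, D i & gen (X i) w]); last first.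
  by move=> v [i Di Xv]; exists i => //; exact: sub_gen.
split; first by exists i0 => //; exact: (gen_subspace _).1.
move=> a v u [i Di Xv] [j Dj Xu]; have [k Dk [ik jk]] := dir i j Di Dj.
by exists k => //; apply: (gen_subspace _).2; [exact: (gen_mono ik)|exact: (gen_mono jk)].
Qed.

(** Passing to one common finite set [D] lets sums with different supports be combined term by
    term. *)
Lemma fsum_finsupp (I : choiceType) (D : set I) (F : I -> V) :
  finite_set D -> (forall i, ~ D i -> F i = 0) ->
  \sum_(i \in [set: I]) F i = \sum_(i <- finmap.enum_fset (fset_set D)) F i.
Proof.
move=> fD F0; rewrite -fsbig_finite //; apply/esym/fsbig_widen => // i [_].
exact: F0.
Qed.

Lemma fsum_lin (I : choiceType) (b : I -> V) a (x y : I -> K) :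
    finite_set [set i | x i != 0] -> finite_set [set i | y i != 0] ->
  finite_set [set i | a * x i + y i != 0] /\
  \sum_(i \in [set: I]) (a * x i + y i) *: b i =
  a *: \sum_(i \in [set: I]) x i *: b i + \sum_(i \in [set: I]) y i *: b i.
Proof.
move=> fx fy; set D := [set i | x i != 0] `|` [set i | y i != 0].
have fD : finite_set D by rewrite finite_setU.
have Dx i : ~ D i -> x i = 0.
  by move=> nD; apply/eqP; apply: contra_notT nD; left.
have Dy i : ~ D i -> y i = 0.
  by move=> nD; apply/eqP; apply: contra_notT nD; right.
split.
  apply: (sub_finite_set _ fD) => i /=; apply: contra_neqP => nD.
  by rewrite Dx // Dy // mulr0 addr0.
rewrite !(fsum_finsupp fD); first last.
- by move=> i nD; rewrite Dx // Dy // mulr0 addr0 scale0r.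
- by move=> i nD; rewrite Dx // scale0r.
- by move=> i nD; rewrite Dy // scale0r.
rewrite scaler_sumr -big_split /=; apply: eq_bigr => i _.
by rewrite scalerDl scalerA.
Qed.

Lemma gen_range_expand (I : choiceType) (b : I -> V) v : gen (range b) v ->
  exists2 x : I -> K, finite_set [set i | x i != 0] &
    v = \sum_(i \in [set: I]) x i *: b i.
Proof.
move: v; apply: gen_min.
  split.
    exists (fun=> 0); last by rewrite fsbig1 // => i _; rewrite scale0r.
    rewrite (_ : [set _ | _] = set0); first exact: finite_set0.
    by apply/seteqP; split=> i //=; rewrite eqxx.
  move=> a _ _ [x fx ->] [y fy ->]; have [fxy <-] := fsum_lin b a fx fy.
  by exists (fun i => a * x i + y i).
move=> _ [i _ <-]; exists (fun j => (j == i)%:R).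
  apply: (sub_finite_set _ (finite_set1 i)) => j /=.
  by have [//|] := eqVneq j i; rewrite eqxx.
rewrite -(fsbig_widen [set i]) ?fsbig_set1 ?eqxx ?scale1r //.
by move=> j [_ /= ji]; rewrite (introF eqP ji) scale0r.
Qed.

(** A coefficient-free form of independence, suited to exchange and to Zorn's lemma; [indep_basis]
    turns it into freeness. *)
Definition indep B := forall b, B b -> ~ gen (B `\ b) b.

End Subspaces.

(** * Independent sets and bases over a division ring *)

Section DivisionRing.
Context (K : unitRingType) (hK : is_division_ring K) (V : lmodType K).
Implicit Types (A B S : set V) (v w : V).

Lemma subspace_unscale S a v : is_subspace S -> a != 0 -> S (a *: v) -> S v.
Proof.
move=> hS a0 /(subspaceZ a^-1 hS); rewrite scalerA mulVr ?scale1r //; exact: hK.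
Qed.

Lemma scale_neq0 (a : K) v : a != 0 -> v != 0 -> a *: v != 0.
Proof.
move=> a0; apply: contra_neq => av0.
by rewrite -[v]scale1r -(mulVr (hK a0)) -scalerA av0 scaler0.
Qed.

Lemma scale_inj v : v != 0 -> injective (fun a : K => a *: v).
Proof.
move=> v0 a b /eqP; rewrite -subr_eq0 -scalerBl => h.
by apply/eqP; rewrite -subr_eq0; apply: contraTT h => ab; exact: scale_neq0.
Qed.

(** Steinitz exchange: the coefficient of [v] in [w] is nonzero, as otherwise [w] would lie in
    [gen A], so it can be inverted. *)
Lemma gen_exchange A v w : gen (v |` A) w -> ~ gen A w -> gen (w |` A) v.
Proof.
case/gen_setU1 => a [y [Ay ->]] nw.
have [a0|a0] := eqVneq a 0; first by case: nw; rewrite a0 scale0r add0r.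
apply: (subspace_unscale (gen_subspace _) a0); rewrite -[X in gen _ X](addrK y).
apply: (subspaceB (gen_subspace _)); first by apply: sub_gen; left.
by apply: gen_mono Ay => u; right.
Qed.

Lemma setU1_indep B v : indep B -> ~ gen B v -> indep (v |` B).
Proof.
move=> iB nv b [->|Bb] h.
  apply: nv; apply: gen_mono h; rewrite setDUl setDv set0U; exact: subDsetl.
apply: nv; apply: (@gen_mono _ _ (b |` (B `\ b))); first by move=> u [->|[]].
apply: gen_exchange; last exact: iB.
by apply: gen_mono h => u [[->|Bu] ub]; [left|right].
Qed.

(** Zorn's lemma yields a maximal independent subset of [A]; a vector of [A] outside its span could
    still be adjoined by [setU1_indep]. *)
Lemma exists_indep A : exists B, [/\ B `<=` A, indep B & A `<=` gen B].
Proof.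
have [F FP tot|B [[BA iB] Bmax]] :=
    @Zorn_bigcup V [set B | B `<=` A /\ indep B].
  split=> [v [X FX Xv]|b [X0 FX0 X0b] h]; first by have [XA _] := FP X FX; exact: XA.
  (* Only the chain members containing [b] are kept, because [b] has to belong to a member for its
     independence to be contradicted. *)
  have : gen (\bigcup_(X in [set X | F X /\ X b]) (X `\ b)) b.
    apply: gen_mono h => v [[X FX Xv] vb].
    have [XX0|X0X] := tot X X0 FX FX0.
      by exists X0; split=> //; exact: XX0.
    by exists X; split=> //; exact: X0X.
  case/gen_bigcup_directed.
  - by exists X0.
  - move=> X Y [FX Xb] [FY Yb]; have [XY|YX] := tot X Y FX FY.
      by exists Y => //; split=> //; exact: setSD.
    by exists X => //; split=> //; exact: setSD.
  - by move=> X [FX Xb]; have [_ iX] := FP X FX; exact: iX.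
exists B; split=> // v Av; apply: contrapT => nv.
apply: (Bmax (v |` B)); last first.
  by split; [move=> u [->//|/BA]|exact: setU1_indep].
split; first by move=> u; right.
by move=> /(_ v (or_introl erefl)) /sub_gen.
Qed.

(** If [x j] were nonzero, solving for [val j] would put it into the span of the other vectors.
    Assuming membership in that span instead of a zero sum serves both freeness and
    [indep_bigcap]. *)
Lemma indep_fsum0 B (x : B -> K) (j : B) : indep B ->
  finite_set [set i | x i != 0] ->
  gen (B `\ val j) (\sum_(i \in [set: B]) x i *: (val i : V)) -> x j = 0.
Proof.
move=> iB fx h; apply: contrapT => /eqP xj0; apply: (iB (val j)).
  by apply: set_mem; exact: valP.
have hg := gen_subspace (B `\ val j).
apply: (subspace_unscale hg xj0).
set D := [set i | x i != 0] in fx.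
rewrite -(fsbig_widen D) // in h; last first.
  by move=> i [_ /= /negP]; rewrite negbK => /eqP ->; rewrite scale0r.
rewrite (fsbigD1 j) //= in h.
rewrite -[X in gen _ X](addrK (\sum_(i \in D `\ j) x i *: (val i : V))).
apply: (subspaceB hg) => //; apply: (subspace_fsum hg) => i [_ ij].
apply: (subspaceZ _ hg); apply: sub_gen; split=> /=.
  by apply: set_mem; exact: valP.
by move=> /val_inj.
Qed.

Lemma indep_basis B : indep B -> is_basis (gen B) (fun i : B => val i : V).
Proof.
move=> iB; split; last first.
  congr gen; apply/seteqP; split=> [_ [i _ <-]|v Bv].
    by apply: set_mem; exact: valP.
  by exists (SigSub (mem_set Bv)).
move=> x fx x0 j; apply: (indep_fsum0 iB fx).
by rewrite x0; exact: (gen_subspace _).1.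
Qed.

(** Membership in the hyperplane spanned by the vectors of [B] other than [b] kills the coordinate
    at [b]. Directness of the final sum rests on this. *)
Lemma indep_bigcap B v : indep B -> gen B v ->
  (forall b, B b -> gen (B `\ b) v) -> v = 0.
Proof.
move=> iB; have [_ <-] := indep_basis iB => /gen_range_expand[x fx ->] h.
apply: fsbig1 => i _; rewrite (indep_fsum0 iB fx) ?scale0r //.
by apply: h; apply: set_mem; exact: valP.
Qed.

(** * Points and lines *)

Definition kline v : set V := [set a *: v | a in [set: K]].

Lemma kline_subspace v : is_subspace (kline v).
Proof.
split=> [|c _ _ [a _ <-] [b _ <-]]; first by exists 0 => //; rewrite scale0r.
by exists (c * a + b) => //; rewrite scalerDl scalerA.
Qed.

Lemma kline_id v : kline v v.
Proof. by exists 1 => //; rewrite scale1r. Qed.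

Lemma kline_sub S v : is_subspace S -> S v -> kline v `<=` S.
Proof. by move=> hS Sv _ [a _ <-]; exact: subspaceZ. Qed.

Lemma gen_set1 v : gen [set v] = kline v.
Proof.
apply/seteqP; split.
  by apply: gen_min; [exact: kline_subspace|move=> _ ->; exact: kline_id].
by apply: kline_sub; [exact: gen_subspace|exact: sub_gen].
Qed.

Lemma kline_eq v w : w != 0 -> kline v w -> kline w = kline v.
Proof.
move=> w0 vw; apply/seteqP; split; first exact: kline_sub (kline_subspace v) vw.
case: vw w0 => a _ <- w0; apply: kline_sub; first exact: kline_subspace.
apply: (subspace_unscale (kline_subspace _)); last exact: kline_id.
by apply: contra_neq w0 => ->; rewrite scale0r.
Qed.

Lemma fsum_finType (I : finType) (F : I -> V) :
  \sum_(i \in [set: I]) F i = \sum_i F i.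
Proof.
rewrite [RHS]bigfs ?index_enum_uniq //; last first.
  by move=> i _ /negP[]; exact: mem_index_enum.
by apply: eq_fsbigl; apply/seteqP; split.
Qed.

Lemma is_pointP S : is_point S <-> exists2 w, w != 0 & S = kline w.
Proof.
split=> [[b [fb <-]]|[w w0 ->]].
  exists (b ord0); last first.
    rewrite -gen_set1; congr gen; apply/seteqP; split=> [_ [i _ <-]|_ ->].
      by rewrite [i]ord1.
    by exists ord0.
  apply/eqP => b0; have := @fb (fun=> 1) finite_finset.
  rewrite fsum_finType big_ord1 b0 scaler0 => /(_ erefl ord0) /eqP.
  by rewrite oner_eq0.
exists (fun=> w); split.
  move=> x _; rewrite fsum_finType big_ord1 => xw i; rewrite [i]ord1.
  by apply: (scale_inj w0); rewrite /= xw scale0r.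
by rewrite -gen_set1; congr gen; apply/seteqP; split=> [_ [i _ <-]|_ ->] //; exists ord0.
Qed.

(** Two exchanges bring first [v] and then [w] into a given basis of the line. *)
Lemma is_line_gen2 S v w : is_line S -> S v -> S w -> v != 0 -> ~ kline v w ->
  S = gen [set v; w].
Proof.
move=> [b [_ bS]] Sv Sw v0 nvw; apply/seteqP; split; last first.
  by rewrite -bS; apply: gen_sub => _ [->|->]; rewrite bS.
have {bS} [s [t bS]] : exists s t, S = gen (s |` [set t]).
  exists (b ord0), (b ord_max); rewrite -bS; congr gen.
  apply/seteqP; split=> [_ [i _ <-]|_ [->|->]]; last 2 first.
  - by exists ord0.
  - by exists ord_max.
  by case: i => -[|[|//]] p; [left|right]; congr b; exact: val_inj.
(* If [v] lies in the span of [t] it replaces [t], otherwise it replaces [s]. *)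
have {s t bS} [t bS] : exists t, S = gen (t |` [set v]).
  have Sst := Sv; rewrite bS in Sst.
  have [tv|tv] := pselect (gen [set t] v).
    exists s; rewrite bS; apply/seteqP; split; apply: gen_sub => _ [->|->].
    - by apply: sub_gen; left.
    - apply: gen_mono (_ : v |` set0 `<=` _) _ _; first by move=> u [->|//]; right.
      apply: gen_exchange; first by rewrite setU0.
      rewrite (_ : gen set0 = [set 0]) /=; first by move/eqP; apply/negP.
      apply/seteqP; split; last by move=> _ ->; exact: (gen_subspace _).1.
      apply: gen_min => //; split=> // a _ _ -> ->.
      by rewrite scaler0 addr0.
    - by apply: sub_gen; left.
    - exact: Sst.
  exists t; rewrite bS; apply/seteqP; split; apply: gen_sub => _ [->|->].
  - by rewrite setUC; exact: gen_exchange.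
  - by apply: sub_gen; left.
  - by apply: sub_gen; right.
  - exact: Sst.
rewrite bS; apply: gen_sub => _ [->|->]; last by apply: sub_gen; left.
by rewrite setUC; apply: gen_exchange; [rewrite -bS|rewrite gen_set1].
Qed.

End DivisionRing.

(** * Eigenvectors and transversals *)

Section Eigenvectors.
Context (K : unitRingType) (hK : is_division_ring K) (U : lmodType K).
Context (phi : representation U).
Implicit Types (S : set U) (u v : U) (k l a b : K) (alpha beta : K -> K).

Lemma repr0 u : phi 0 u = 0.
Proof. by apply: (addrI (phi 0 u)); rewrite -reprD !addr0. Qed.

Lemma reprK k : k != 0 -> cancel (phi k) (phi k^-1).
Proof. by move=> k0 u; rewrite -reprM divrr ?repr1 //; exact: hK. Qed.

Lemma repr_eq0 k u : k != 0 -> (phi k u == 0) = (u == 0).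
Proof.
by move=> k0; apply/eqP/eqP => [h|->]; rewrite ?linear0 // -(reprK k0 u) h linear0.
Qed.

Definition stable S := forall k u, S u -> S (phi k u).

Lemma PKP p :
  PK p <-> exists k l, (k != 0) || (l != 0) /\ p = Kspan k l.
Proof.
split=> [/(is_pointP hK)[[k l] kl0 ->]|[k [l [kl0 ->]]]].
  exists k, l; split=> //; apply: contra_neqT kl0.
  by rewrite negb_or !negbK => /andP[/eqP -> /eqP ->].
apply/(is_pointP hK); exists (k, l) => //; apply: contraTneq kl0 => -[-> ->].
by rewrite eqxx.
Qed.

Lemma stable_graph S k l : stable S -> (k != 0) || (l != 0) ->
  graph_sub phi k l `&` (S `*` S) = [set (phi k u, phi l u) | u in S].
Proof.
move=> hS kl; apply/seteqP; split=> [_ [[u _ <-] [/= Sk Sl]]|_ [u Su <-]].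
  (* One of [k], [l] is invertible, so [u] is recovered from [phi k u] or [phi l u] by the inverse
     scalar without leaving [S]. *)
  exists u => //; case/orP: kl => h; rewrite -(reprK h u); exact: hS.
by split; [exists u|split; exact: hS].
Qed.

(** For [a != 0] the multiple [a *: u] has the conjugate eigenvalue map [a * alpha k * a^-1]. Hence
    the vectors with a fixed [alpha] need not form a subspace, and their span is taken below. *)
Definition eig alpha u := forall k, phi k u = alpha k *: u.

Definition surj alpha := forall a, exists k, alpha k = a.

Definition sq u : set (U * U)%type := kline u `*` kline u.

Lemma setX_subspace S : is_subspace S -> is_subspace (S `*` S).
Proof.
move=> [S0 hS]; split=> // a [v1 v2] [w1 w2] [/= Sv1 Sv2] [/= Sw1 Sw2].
by split; exact: hS.
Qed.

Lemma eig_stable alpha u : eig alpha u -> stable (kline u).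
Proof.
move=> e k _ [a _ <-]; rewrite linearZ /= e scalerA; by exists (a * alpha k).
Qed.

Lemma sq_graph alpha u k l : eig alpha u -> (k != 0) || (l != 0) ->
  sq u `&` graph_sub phi k l = kline (phi k u, phi l u).
Proof.
move=> e kl; rewrite setIC stable_graph //; last exact: eig_stable e.
apply/seteqP; split=> [_ [_ [a _ <-] <-]|_ [a _ <-]].
  by exists a; rewrite // !linearZ.
by exists (a *: u); [exists a|rewrite !linearZ].
Qed.

Lemma pair_repr_neq0 k l u : u != 0 -> (k != 0) || (l != 0) ->
  (phi k u, phi l u) != 0.
Proof.
move=> u0 /orP[] h; apply/eqP => -[/eqP + /eqP]; last move=> _;
  by rewrite repr_eq0 // (negbTE u0).
Qed.

Lemma is_line_sq u : u != 0 -> is_line (sq u).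
Proof.
move=> u0; exists (fun i : 'I_2 => if i == ord0 then (u, 0) else (0, u)); split.
  move=> x _; rewrite fsum_finType !big_ord_recl big_ord0 /= addr0 => -[].
  rewrite scaler0 addr0 scaler0 add0r => x0 x1.
  have h a : a *: u = 0 -> a = 0.
    by move=> au; apply: (scale_inj hK u0); rewrite /= au scale0r.
  case=> -[|[|//]] p; [rewrite -(h _ x0)|rewrite -(h _ x1)];
    by congr x; exact: val_inj.
have hsq := setX_subspace (kline_subspace u).
have k0 : kline u 0 := (kline_subspace u).1.
apply/seteqP; split; [apply: gen_min => // _ [i _ <-]; case: ifP => _; split => //=|].
- exact: kline_id.
- exact: kline_id.
move=> [_ _] [[a _ /= <-] [b _ /= <-]].
have -> : (a *: u, b *: u) = a *: (u, 0) + b *: (0, u) :> U * U.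
  by congr pair; rewrite /= scaler0 ?addr0 ?add0r.
have hg := gen_subspace (range (fun i : 'I_2 => if i == ord0 then (u, 0) else (0, u))).
apply: hg.2; first by apply: sub_gen; exists ord0.
apply: (subspaceZ _ hg); apply: sub_gen; by exists ord_max.
Qed.

(** The eigenvector property makes each intersection the single point of [sq_graph]. Surjectivity
    writes any [(a *: u, b *: u)] as [(phi k u, phi l u)], so every point is covered. *)
Lemma eig_transversal alpha u : u != 0 -> eig alpha u -> surj alpha ->
  is_transversal_line phi (sq u).
Proof.
move=> u0 e sa; split; first exact: is_line_sq.
  move=> _ /PKP[k [l [kl ->]]]; rewrite Phi_Kspan.
  have w0 := pair_repr_neq0 u0 kl.
  exists (kline (phi k u, phi l u)); rewrite -(sq_graph e kl); split.
    split=> //; rewrite (sq_graph e kl); apply/(is_pointP hK).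
    by exists (phi k u, phi l u).
  move=> _ [/(is_pointP hK)[w w1 ->] wsq wg]; rewrite (sq_graph e kl).
  apply/esym; apply: (kline_eq hK) => //; rewrite -(sq_graph e kl).
  by split; [apply: wsq|apply: wg]; exact: kline_id.
move=> _ /(is_pointP hK)[w w0 ->] /(_ _ (kline_id w)).
case: w w0 => [x y] w0 [[a _ /= Ea] [b _ /= Eb]].
have [k ak] := sa a; have [l bl] := sa b.
rewrite -{}Ea -{}Eb -{}ak -{}bl -!e in w0 *.
have kl : (k != 0) || (l != 0).
  apply: contra_neqT w0; rewrite negb_or !negbK => /andP[/eqP -> /eqP ->].
  by rewrite repr0.
exists (Kspan k l); first by apply/PKP; exists k, l.
rewrite Phi_Kspan -(sq_graph e kl); exact: subIsetr.
Qed.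

(** The points of [T] on the images of K(1,0), K(0,1) and K(1,1) determine its shape, those on the
    images of K(1,k) give the eigenvalues, and the covering of the points of [T] gives
    surjectivity. *)
Lemma transversal_eig T : is_transversal_line phi T ->
  exists u alpha, [/\ u != 0, eig alpha u, surj alpha & T = sq u].
Proof.
move=> [lT pT sT].
have pt k l : (k != 0) || (l != 0) ->
    exists2 w, w != 0 & T (phi k w, phi l w).
  move=> kl; have [|q [[/(is_pointP hK)[w w0 ->] qT qP] _]] := pT (Kspan k l).
    by apply/PKP; exists k, l.
  rewrite Phi_Kspan in qP; have [v _ E] := qP _ (kline_id w).
  exists v; last by rewrite E; apply: qT; exact: kline_id.
  by apply: contra_neq w0 => v0; rewrite -E v0 !linear0.
have one0 := oner_neq0 K.
have [|u u0] := pt 1 0; first by rewrite one0.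
have [|v v0] := pt 0 1; first by rewrite one0 orbT.
have [|w w0] := pt 1 1; first by rewrite one0.
rewrite !repr1 !repr0 => Tw Tv Tu.
(* The points [(u, 0)] and [(0, v)] span [T]; since [(w, w)] also lies in [T], both [kline u] and
   [kline v] equal [kline w]. *)
have TE : T = kline u `*` kline v.
  rewrite (is_line_gen2 hK lT Tu Tv).
  - apply/seteqP; split.
      apply: gen_min; last first.
        move=> _ [->|->]; split=> /=; try exact: kline_id; exact: (kline_subspace _).1.
      split; first by split; exact: (kline_subspace _).1.
      move=> a [x1 x2] [y1 y2] [/= X1 X2] [/= Y1 Y2].
      by split; exact: (kline_subspace _).2.
    move=> [_ _] [[a _ /= <-] [b _ /= <-]].
    have -> : (a *: u, b *: v) = a *: (u, 0) + b *: (0, v) :> U * U.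
      by congr pair; rewrite /= scaler0 ?addr0 ?add0r.
    apply: (gen_subspace _).2; first by apply: sub_gen; left.
    by apply: (subspaceZ _ (gen_subspace _)); apply: sub_gen; right.
  - by apply: contra_neq u0 => -[].
  - move=> [a _ [_ /= /esym/eqP]]; rewrite scaler0; exact/negP.
have {TE} TE : T = sq w.
  have := Tw; rewrite TE => -[/= uw vw].
  by rewrite -(kline_eq hK w0 uw) -(kline_eq hK w0 vw).
(* The point on the image of K(1,k) is spanned by [(x, phi k x)] with [x] a nonzero multiple of [w];
   cancelling the scalar puts [phi k w] into [kline w]. *)
have ew k : exists a, phi k w = a *: w.
  have [|x x0] := pt 1 k; first by rewrite one0.
  rewrite TE repr1 => -[/= [a _ E]] h; have a0 : a != 0.
    by apply: contra_neq x0 => a0; rewrite -E a0 scale0r.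
  rewrite -{}E linearZ /= in h.
  by have [b _ <-] := subspace_unscale hK (kline_subspace w) a0 h; exists b.
have [alpha ea] := choice ew; exists w, alpha; split=> // a.
(* The point spanned by [(w, a *: w)] lies on the image of some K(k,l) with [k != 0], and then
   [alpha (k^-1 * l) = a]. *)
have [||p] := sT (kline (w, a *: w)).
- by apply/(is_pointP hK); exists (w, a *: w) => //; apply: contra_neq w0 => -[].
- apply: kline_sub; first by rewrite TE; exact: (setX_subspace (kline_subspace _)).
  by rewrite TE; split=> /=; [exact: kline_id|exists a].
move=> /PKP[k [l [kl ->]]]; rewrite Phi_Kspan => /(_ _ (kline_id _)) [x _ [xk xl]].
have k0 : k != 0 by apply: contra_neq w0 => k0; rewrite -xk k0 repr0.
exists (k^-1 * l); apply: (scale_inj hK w0) => /=.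
by rewrite -ea reprM -{1}xk (reprK k0).
Qed.

(** * Projectively linked transversals and the subspaces they generate *)

(** The default 0 is returned off [kline u]; only values on multiples of [u] matter. *)
Definition coord u v : K := xget 0 [set a | v = a *: u].

Lemma coordZ u a : u != 0 -> coord u (a *: u) = a.
Proof.
move=> u0; rewrite /coord; case: xgetP => [b _ /(scale_inj hK u0)//|/(_ a)].
by case.
Qed.

(** If [u] and [v] share [alpha], then [(a *: u, b *: u) |-> (a *: v, b *: v)] induces the mapping
    between the transversals. Conversely, a linear map inducing it fixes a scalar [c] such that
    [c *: v] has eigenvalue map [alpha]. *)
Lemma link_classP alpha u T : u != 0 -> eig alpha u -> surj alpha ->
  link_class phi (sq u) T <-> exists v, [/\ v != 0, eig alpha v & T = sq v].
Proof.
move=> u0 e sa; split=> [[/transversal_eig[v [beta [v0 ev sb ->]]]]|]; last first.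
  move=> [v [v0 ev ->]]; split; first exact: eig_transversal ev sa.
  pose f w := (coord u w.1 *: v, coord u w.2 *: v).
  have fE a b : f (a *: u, b *: u) = (a *: v, b *: v) by rewrite /f /= !coordZ.
  exists f.
    split.
      move=> c [_ _] [_ _] [[a1 _ /= <-] [a2 _ /= <-]] [[b1 _ /= <-] [b2 _ /= <-]].
      have -> : c *: (a1 *: u, a2 *: u) + (b1 *: u, b2 *: u) =
          ((c * a1 + b1) *: u, (c * a2 + b2) *: u).
        by congr pair; rewrite /= scalerDl scalerA.
      by rewrite !fE; congr pair; rewrite /= scalerDl scalerA.
    split.
    - move=> [_ _] [[a _ /= <-] [b _ /= <-]].
      by rewrite fE; split=> /=; [exists a|exists b].
    - move=> [_ _] [_ _] /set_mem[[a1 _ /= <-] [a2 _ /= <-]]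
        /set_mem[[b1 _ /= <-] [b2 _ /= <-]].
      by rewrite !fE => -[/(scale_inj hK v0) -> /(scale_inj hK v0) ->].
    - move=> [_ _] [[a _ /= <-] [b _ /= <-]].
      exists (a *: u, b *: u); last exact: fE.
      by split=> /=; [exists a|exists b].
  move=> q1 q2 [_ [/PKP[k [l [kl ->]]]]]; rewrite Phi_Kspan.
  rewrite (sq_graph e kl) (sq_graph ev kl) !e !ev => -> ->.
  apply/seteqP; split.
    move=> _ [_ [a _ <-] <-]; exists a => //.
    have -> : a *: (alpha k *: u, alpha l *: u) = ((a * alpha k) *: u, (a * alpha l) *: u).
      by congr pair; rewrite /= scalerA.
    by rewrite fE; congr pair; rewrite /= scalerA.
  move=> _ [a _ <-]; exists ((a * alpha k) *: u, (a * alpha l) *: u).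
    by exists a => //; congr pair; rewrite /= scalerA.
  by rewrite fE; congr pair; rewrite /= scalerA.
move=> [f [flin _] fpi].
have fp k l : (k != 0) || (l != 0) ->
    f @` kline (phi k u, phi l u) = kline (phi k v, phi l v).
  move=> kl; apply: fpi; exists (Kspan k l); split; first by apply/PKP; exists k, l.
    by rewrite Phi_Kspan (sq_graph e kl).
  by rewrite Phi_Kspan (sq_graph ev kl).
have fp1 k l : (k != 0) || (l != 0) ->
    exists a, f (phi k u, phi l u) = (a *: phi k v, a *: phi l v).
  move=> kl.
  have : (f @` kline (phi k u, phi l u)) (f (phi k u, phi l u)).
    by exists (phi k u, phi l u) => //; exact: kline_id.
  by rewrite fp // => -[a _ <-]; exists a.
have one0 := oner_neq0 K.
have [|c] := fp1 1 0; first by rewrite one0.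
have [|d] := fp1 0 1; first by rewrite one0 orbT.
rewrite !repr1 !repr0 !scaler0 => fd fc.
have hk0 := (kline_subspace u).1.
have Tu0 : sq u (u, 0) by split=> //=; exact: kline_id.
have T0u : sq u (0, u) by split=> //=; exact: kline_id.
(* Linearity computes this value from the images of [(u, 0)] and [(0, u)]; comparison with the point
   prescribed on the image of K(1,k) then relates [alpha] to the action on [v]. *)
have fk k : f (u, phi k u) = (c *: v, alpha k *: (d *: v)).
  have -> : (u, phi k u) = alpha k *: (0, u) + (u, 0).
    by congr pair; rewrite /= ?scaler0 ?add0r // e addr0.
  rewrite flin // fd fc; congr pair; rewrite /= ?scaler0 ?add0r //.
  by rewrite addr0.
have fk1 k : alpha k *: (d *: v) = c *: phi k v.
  have [|a] := fp1 1 k; first by rewrite one0.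
  rewrite !repr1 fk => -[/(scale_inj hK v0) ->]; exact.
have dc : d = c.
  have := fk1 1; have a1 : alpha 1 = 1.
    by apply: (scale_inj hK u0); rewrite /= -e repr1 scale1r.
  by rewrite a1 scale1r repr1 => /(scale_inj hK v0).
(* With [c = 0] the map would kill the point spanned by [(u, 0)], whose image is the point spanned
   by [(v, 0)]. *)
have c0 : c != 0.
  apply/eqP => c0; have := fp 1 0; rewrite one0 => /(_ erefl).
  rewrite !repr1 !repr0 => E.
  have := kline_id (v, 0 : U).
  rewrite -E => -[_ [a _ <-]]; rewrite -[_ *: _]addr0 flin //.
  have f0 : f 0 = 0.
    have := flin 1 0 0; rewrite scaler0 addr0 scale1r => /(_ _ _)/eqP.
    rewrite -subr_eq0 opprD addrA subrr sub0r oppr_eq0 => h.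
    by apply/eqP; apply: h; split; exact: hk0.
  rewrite f0 addr0 fc c0 scale0r => -[/esym/eqP].
  by rewrite scaler0 (negbTE v0).
have cv0 : c *: v != 0 by exact: scale_neq0.
exists (c *: v); split=> //.
  by move=> k; rewrite linearZ /= -fk1 dc.
have vcv : kline v (c *: v) by exists c.
by rewrite /sq (kline_eq hK cv0 vcv).
Qed.

Lemma link_class_eq alpha u v : u != 0 -> v != 0 -> surj alpha ->
  eig alpha u -> eig alpha v -> link_class phi (sq u) = link_class phi (sq v).
Proof.
move=> u0 v0 sa eu ev; apply/predeqP => T.
by split=> /(link_classP _ _ _ sa) h; apply/(link_classP _ _ _ sa) => //; exact: h.
Qed.

(** Each eigenvector [v] for [alpha] contributes both [(v, 0)] and [(0, v)], so the two coordinates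
    can be generated independently. *)
Lemma gen_link_class alpha u : u != 0 -> eig alpha u -> surj alpha ->
  gen_union (link_class phi (sq u)) =
  gen [set v | eig alpha v] `*` gen [set v | eig alpha v].
Proof.
move=> u0 e sa; set E := [set v | eig alpha v]; set G := gen_union _.
have hG : is_subspace G := gen_subspace _.
have hE := gen_subspace E.
apply/seteqP; split.
  apply: gen_min; first exact: setX_subspace.
  move=> w [T /(link_classP _ u0 e sa)[v [v0 ev ->]] [w1 w2]].
  have vE := kline_sub hE (sub_gen ev : gen E v).
  by split; exact: vE.
have GE v : E v -> G (v, 0) /\ G (0, v).
  move=> Ev; have [->|v0] := eqVneq v 0; first by split; exact: hG.1.
  have k0 := (kline_subspace v).1; have kv := kline_id v.
  have Tv : link_class phi (sq u) (sq v) by apply/(link_classP _ u0 e sa); exists v.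
  by split; apply: sub_gen; exists (sq v).
have G1 : gen E `<=` [set v | G (v, 0)].
  apply: gen_min => [|v /GE[]//]; split; first exact: hG.1.
  move=> a v w /= Gv Gw; rewrite (_ : (_, 0) = a *: (v, 0) + (w, 0)); first exact: hG.2.
  by congr pair; rewrite /= scaler0 addr0.
have G2 : gen E `<=` [set v | G (0, v)].
  apply: gen_min => [|v /GE[]//]; split; first exact: hG.1.
  move=> a v w /= Gv Gw; rewrite (_ : (0, _) = a *: (0, v) + (0, w)); first exact: hG.2.
  by congr pair; rewrite /= scaler0 addr0.
move=> [v w] [/= /G1 Gv /G2 Gw].
rewrite (_ : (v, w) = (v, 0) + (0, w)); first exact: (subspaceD hG).
by congr pair; rewrite /= ?addr0 ?add0r.
Qed.

(** * Components of eigenvectors along a basis of eigenvectors *)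

(** The eigenvalue map may vary with the vector, so the lemma also applies to hyperplanes spanned by
    basis vectors of different classes. *)
Lemma gen_stable (A : set U) : (forall u, A u -> exists alpha, eig alpha u) ->
  stable (gen A).
Proof.
move=> hA k; apply: (@gen_min _ _ A [set v | gen A (phi k v)]).
  have hg := gen_subspace A.
  split=> [|a v w /= Av Aw]; rewrite /= ?linear0; first exact: hg.1.
  by rewrite linearP; exact: hg.2.
move=> u Au; have [alpha e] := hA u Au; rewrite /= e.
by apply: (subspaceZ _ (gen_subspace _)); exact: sub_gen.
Qed.

(* Comparing u.k computed from u = x b + h with alpha(k) u gives
   alpha(k) x = x beta(k), so x b has the same eigenvalue map as u. *)
Lemma eig_component (B : set U) (b u : U) alpha beta : indep B ->
    (forall v, B v -> exists gamma, eig gamma v) -> B b -> eig beta b ->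
    eig alpha u -> gen B u -> ~ gen (B `\ b) u ->
  exists2 x, x != 0 & eig alpha (x *: b).
Proof.
move=> iB eB Bb ebeta e Bu nBu; set H := gen _ in nBu.
have hH : is_subspace H := gen_subspace _.
have sH : stable H by apply: gen_stable => v [/eB].
have : gen (b |` (B `\ b)) u.
  by apply: gen_mono Bu => v Bv; have [->|/eqP vb] := eqVneq v b; [left|right].
case/gen_setU1 => x [h [Hh uE]]; exists x.
  by apply: contra_notN nBu => /eqP x0; rewrite uE x0 scale0r add0r.
move=> k; rewrite linearZ /= ebeta !scalerA.
apply/eqP; rewrite -subr_eq0 -scalerBl; apply/eqP.
have [->|d0] := eqVneq (x * beta k - alpha k * x) 0; first by rewrite scale0r.
case: (iB b Bb); apply: (subspace_unscale hK hH d0).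
rewrite (_ : _ *: b = alpha k *: h - phi k h); last first.
  have := e k; rewrite uE linearD linearZ /= ebeta scalerDr !scalerA.
  move=> /(canRL (addrK _)) E.
  by rewrite scalerBl E [_ + alpha k *: h]addrC [LHS]addrAC addrK.
by apply: (subspaceB hH); [exact: (subspaceZ _ hH)|exact: sH].
Qed.

(** * The trace on a summand as a regulus *)

Lemma repr_fsum (I : choiceType) (b : I -> U) (x : I -> K) alpha k :
    (forall i, eig alpha (b i)) -> finite_set [set i | x i != 0] ->
  phi k (\sum_(i \in [set: I]) x i *: b i) =
  \sum_(i \in [set: I]) (x i * alpha k) *: b i.
Proof.
move=> eb fx; set D := [set i | x i != 0] in fx.
have D0 i : ~ D i -> x i = 0 by move=> /negP; rewrite negbK => /eqP.
rewrite !(fsum_finsupp fx); first last.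
- by move=> i /D0 ->; rewrite scale0r.
- by move=> i /D0 ->; rewrite mul0r scale0r.
rewrite linear_sum; apply: eq_bigr => i _.
by rewrite linearZ /= eb scalerA.
Qed.

Lemma trace_regulus alpha u : u != 0 -> eig alpha u -> surj alpha ->
  is_regulus (gen [set v | eig alpha v]) (trace phi (gen [set v | eig alpha v])).
Proof.
move=> u0 e sa; set E := [set v | eig alpha v].
have sE : stable (gen E) by apply: gen_stable => v Ev; exists alpha.
split; first exact: gen_subspace.
  move=> E0; have : gen E u by exact: sub_gen.
  by rewrite E0 => /= /eqP; apply/negP.
(* The basis is picked inside [E], so that [K] acts on all its vectors through the same [alpha]. The
   trace is then the standard regulus itself, with [g] the identity. *)
have [B [BE iB EB]] := exists_indep hK E.
have BEq : gen B = gen E.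
  by apply/seteqP; split; apply: gen_sub => // v /BE; exact: sub_gen.
have eB (i : B) : eig alpha (val i) by apply: BE; apply: set_mem; exact: valP.
have bB := indep_basis hK iB; rewrite BEq in bB.
exists B, (fun i : B => val i), id; split=> //.
  by split=> //; split=> // w Ww; exists w.
have elt k l : (k != 0) || (l != 0) -> Phi phi (Kspan k l) `&` (gen E `*` gen E) =
    std_regulus_elt (fun i : B => val i : U) (alpha k) (alpha l).
  move=> kl; rewrite Phi_Kspan stable_graph //; apply/seteqP; split.
    move=> _ [v + <-]; rewrite -bB.2 => /gen_range_expand[x fx ->].
    by exists x => //; rewrite !(repr_fsum _ eB fx).
  move=> _ [x fx <-]; exists (\sum_(i \in [set: B]) x i *: (val i : U)).
    apply: (subspace_fsum (gen_subspace _)) => i _.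
    by apply: (subspaceZ _ (gen_subspace _)); apply: sub_gen; exact: eB.
  by rewrite !(repr_fsum _ eB fx).
(* Since [phi k] is injective for [k != 0], the pair [(alpha k, alpha l)] is nonzero exactly when
   [(k, l)] is; surjectivity of [alpha] then yields every element of the standard regulus. *)
have nz k : (alpha k != 0) = (k != 0).
  have [->|k0] := eqVneq k 0.
    apply/negbTE; rewrite negbK; apply/eqP; apply: (scale_inj hK u0).
    by rewrite /= -e repr0 scale0r.
  apply/eqP => a0; have := repr_eq0 u k0; rewrite e a0 scale0r eqxx.
  by rewrite (negbTE u0).
apply/seteqP; split.
  move=> _ [_ /PKP[k [l [kl ->]]] <-]; rewrite elt //.
  eexists; last exact: image_id.
  exists (alpha k, alpha l) => //=; apply/PKP; exists (alpha k), (alpha l).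
  by rewrite !nz.
move=> _ [_ [[a b] /= + ->] <-]; rewrite image_id.
move=> /PKP[a' [b' [ab' E']]].
have [k ka] := sa a; have [l lb] := sa b.
have kl : (k != 0) || (l != 0).
  apply: contraT; rewrite -(nz k) -(nz l) ka lb negb_or !negbK => /andP[/eqP a0 /eqP b0].
  have : Kspan a' b' (a', b') by exists 1 => //; rewrite !mul1r.
  rewrite -E' a0 b0 => -[c _ []]; rewrite !mulr0 => a'0 b'0.
  by rewrite -a'0 -b'0 eqxx in ab'.
exists (Kspan k l); first by apply/PKP; exists k, l.
by rewrite elt // ka lb.
Qed.

End Eigenvectors.

(** * The direct decomposition into the summands of the link classes *)

Unset Implicit Arguments.

Theorem theorem3p3 (K : unitRingType) (hK : is_division_ring K)
    (U : lmodType K) (hU : exists u : U, u != 0) (phi : representation U)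
    (hspan : gen_union [set T | is_transversal_line phi T] = [set: U * U]) :
  exists Usub : set (set (U * U)%type) -> set U,
    [/\ forall C, link_classes phi C ->
          is_subspace (Usub C) /\ Usub C `*` Usub C = gen_union C,
        is_direct_sum (link_classes phi) (fun C => Usub C `*` Usub C)
          [set: U * U] &
        forall C, link_classes phi C -> is_regulus (Usub C) (trace phi (Usub C))].
Proof.
(* A class carries no distinguished eigenvector, so its subspace of [U] is read off from the first
   coordinates of the subspace it generates. *)
pose W (C : set (set (U * U)%type)) : set U := [set u | gen_union C (u, 0)].
exists W.
have classP C : link_classes phi C -> exists u alpha,
    [/\ u != 0, eig phi alpha u, surj alpha, C = link_class phi (sq u) &
        W C = gen [set v | eig phi alpha v]].
  move=> [_ /(transversal_eig hK)[u [alpha [u0 e sa ->]]] <-].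
  exists u, alpha; split=> //; rewrite /W (gen_link_class hK u0 e sa).
  apply/seteqP; split=> [v []//|v Ev]; split=> //=.
  exact: (gen_subspace _).1.
have WP C : link_classes phi C ->
    is_subspace (W C) /\ W C `*` W C = gen_union C.
  move=> /classP[u [alpha [u0 e sa CE ->]]]; split; first exact: gen_subspace.
  by rewrite CE (gen_link_class hK u0 e sa).
split=> //; last first.
  by move=> C /classP[u [alpha [u0 e sa _ ->]]]; exact: trace_regulus u0 e sa.
pose A := [set u | u != 0 /\ exists2 alpha, surj alpha & eig phi alpha u].
have [B [BA iB AB]] := exists_indep hK A.
(* Every transversal lies in [gen B] times [gen B]; as the transversals span everything, [B] is a
   basis of [U] made of eigenvectors. *)
have gBT u : gen B u.
  have hB := setX_subspace (gen_subspace B).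
  have : (gen B `*` gen B) (u, 0).
    have : [set: U * U] (u, 0) by [].
    rewrite -hspan; apply: (gen_min hB) => w [T].
    move=> /(transversal_eig hK)[v [alpha [v0 e sa ->]]] [w1 w2].
    have Av : A v by split=> //; exists alpha.
    by split; apply: (kline_sub (gen_subspace B) (AB _ Av)).
  by case.
have eB v : B v -> exists alpha, eig phi alpha v.
  by move=> /BA[_ [alpha _ e]]; exists alpha.
(* An eigenvector of the class [C] outside this hyperplane would have a nonzero component along [b]
   with the same eigenvalue map, forcing [b] into the class [C]. *)
have hyper C b : link_classes phi C -> B b -> C <> link_class phi (sq b) ->
    W C `<=` gen (B `\ b).
  move=> /classP[u [alpha [u0 e sa -> ->]]] Bb Cb.
  have [b0 [beta _ eb]] := BA b Bb.
  apply: (gen_min (gen_subspace _)) => v ev; apply: contrapT => nv.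
  have [x x0 exb] := eig_component hK iB eB Bb eb ev (gBT v) nv.
  have xb0 := scale_neq0 hK x0 b0.
  have vb : kline b (x *: b) by exists x.
  apply: Cb; rewrite (link_class_eq hK u0 xb0 sa e exb).
  by rewrite /sq (kline_eq hK xb0 vb).
split=> [C /WP[hC _]||C hC]; first exact: setX_subspace.
  apply/seteqP; split=> //; rewrite -hspan.
  apply: (gen_min (gen_subspace _)) => w [T hT Tw]; apply: sub_gen.
  have [u [alpha [u0 e sa TE]]] := transversal_eig hK hT.
  have CT : link_classes phi (link_class phi T) by exists T.
  exists (link_class phi T) => //; have [_ ->] := WP _ CT.
  apply: sub_gen; exists T => //; rewrite TE.
  (* Each transversal belongs to its own class, with [u] itself as witness. *)
  by apply/(link_classP hK _ u0 e sa); exists u.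
have hCs := (WP C hC).1.
apply/seteqP; split=> [[w1 w2] [[/= C1 C2] h]|_ ->]; last first.
  by split; [split; exact: hCs.1|exact: (gen_subspace _).1].
suff hy b : B b -> gen (B `\ b) w1 /\ gen (B `\ b) w2.
  by rewrite /= (indep_bigcap hK iB (gBT w1) (fun b Bb => (hy b Bb).1))
             (indep_bigcap hK iB (gBT w2) (fun b Bb => (hy b Bb).2)).
(* If [b] is not of class [C], the hyperplane contains [W C]. If it is, the hyperplane contains the
   subspaces of all other classes, and [(w1, w2)] lies in their span. *)
move=> Bb; have [Cb|Cb] := pselect (C = link_class phi (sq b)); last first.
  by split; apply: (hyper C).
have hH := setX_subspace (gen_subspace (B `\ b)).
suff : (gen (B `\ b) `*` gen (B `\ b)) (w1, w2) by case.
apply: (gen_min hH) h => w [C' [hC' C'C] [Cw1 Cw2]].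
have C'b : C' <> link_class phi (sq b) by rewrite -Cb.
by split; apply: (hyper C').
Qed.
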